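(* Let $\omega$ be a nonempty factor of $D_\infty$ with $\mathrm{Env}(\omega)=E_{m,i}$, $i\in\{1,2\}$. Then for every $p\ge1$ the occurrence $\omega_p$ has a unique envelope extension $$E_{m,i,p}=\mu_1(\omega)\,\omega_p\,\mu_2(\omega),$$ where $\mu_1(\omega)$ and $\mu_2(\omega)$ are constant words depending only on $\omega$ (not on $p$). That is, there are uniquely determined words $\mu_1(\omega),\mu_2(\omega)$ such that for every $p\ge1$ the $p$-th occurrence of $\omega$ in $D_\infty$ lies inside the $p$-th occurrence of $E_{m,i}$ in $D_\infty$, preceded within it by exactly $\mu_1(\omega)$ and followed within it by exactly $\mu_2(\omega)$.
   Context: Let $\sigma$ be the morphism on $\{a,b\}^*$ with $\sigma(a)=ab$, $\sigma(b)=aa$. The Doubling sequence is $D_\infty=x_1x_2x_3\cdots=\sigma^\infty(a)=abaaabab\cdots$, the infinite fixed point of $\sigma$ beginning with $a$. Put $A_m=\sigma^m(a)$ for $m\ge0$ and let $\delta_m$ be the last letter of $A_m$. For $m\ge1$ the envelope words are $E_{m,1}=A_m\delta_m^{-1}$ (i.e. $A_m$ with its last letter removed) and $E_{m,2}=A_{m-1}A_m\delta_m^{-1}$. They are ordered by: $E_{m_1,i_1}\sqsubset E_{m_2,i_2}$ iff $m_1<m_2$, or $m_1=m_2$ and $i_1<i_2$. For a factor $\omega$ of $D_\infty$, $\mathrm{Env}(\omega)$ is the minimal envelope word (under $\sqsubset$) having $\omega$ as a factor. Every factor $\omega$ of $D_\infty$ occurs infinitely often; $\omega_p$ ($p\ge1$)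 denotes its $p$-th occurrence, occurrences (overlaps allowed) being ordered by starting position. $E_{m,i,p}$ denotes the $p$-th occurrence of $E_{m,i}$ in $D_\infty$. *)

(* Defs.v *)
From HB Require Import structures.
From mathcomp Require Import all_boot.

Set Implicit Arguments.
Unset Strict Implicit.
Unset Printing Implicit Defensive.

Variant letter : Type := La | Lb.

Definition letter_to_bool (x : letter) : bool := if x is Lb then true else false.
Definition bool_to_letter (x : bool) : letter := if x then Lb else La.
Lemma letter_to_boolK : cancel letter_to_bool bool_to_letter.
Proof. by case. Qed.
HB.instance Definition _ := Equality.copy letter (can_type letter_to_boolK).

Definition word : Type := seq letter.

Definition sigma1 (x : letter) : word :=
  match x with La => [:: La; Lb] | Lb => [:: La; La] end.
Definition sigma (w : word) : word := flatten (map sigma1 w).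

Definition A (m : nat) : word := iter m sigma [:: La].
Definition delta (m : nat) : letter := last La (A m).

(* Letters of the infinite word are numbered from 0, so [D n] is x_(n+1).
   Since [A n] has length 2 ^ n > n and each [A m] is a prefix of [A m.+1],
   [D n] can be read off [A n]; see [A_prefix_D] and [D_fixed] below. *)
Definition D (n : nat) : letter := nth La (A n) n.

(* The prefix [A m] with its last letter [delta m] removed, see [A_chop]. *)
Definition chop (w : word) : word := take (size w).-1 w.

(* Only meaningful for [0 < m] and [i] equal to 1 or 2, see [env_index]. *)
Definition E (m i : nat) : word :=
  if i == 1 then chop (A m) else A m.-1 ++ chop (A m).

Definition env_index (m i : nat) : bool := (0 < m) && ((i == 1) || (i == 2)).

Definition env_lt (m1 i1 m2 i2 : nat) : bool :=
  (m1 < m2) || (m1 == m2) && (i1 < i2).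

(* Env(w) = E_{m,i}.  As [env_lt] is a strict total order on indices, "no
   smaller envelope word contains w" is minimality. *)
Definition is_Env (w : word) (m i : nat) : Prop :=
  [/\ env_index m i, infix w (E m i) &
      forall m' i' : nat, env_index m' i' -> infix w (E m' i') ->
        ~~ env_lt m' i' m i].

Definition occurs_at (w : word) (n : nat) : bool :=
  mkseq (fun j => D (n + j)) (size w) == w.

Definition factor_of_D (w : word) : Prop := exists n : nat, occurs_at w n.

(* The p-th occurrence of w (p counted from 1) starts at position n. *)
Definition nth_occurrence (w : word) (p n : nat) : bool :=
  occurs_at w n && (count (occurs_at w) (iota 0 n.+1) == p).

(* E_{m,i,p} = mu1 w_p mu2, as an equality of occurrences in the infinite word:
   the words agree, and w_p starts exactly [size mu1] letters after E_{m,i,p}. *)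
Definition envelope_extension (w : word) (m i p : nat) (mu : word * word)
  : Prop :=
  exists k l : nat,
    [/\ nth_occurrence w p k, nth_occurrence (E m i) p l,
        E m i = mu.1 ++ w ++ mu.2 & k = l + size mu.1].

Lemma size_sigma w : size (sigma w) = (size w).*2.
Proof. by elim: w => [|x w IH] //; rewrite /= doubleS -IH; case: x. Qed.

Lemma AS m : A m.+1 = sigma (A m).
Proof. by []. Qed.

Lemma size_A m : size (A m) = 2 ^ m.
Proof. by elim: m => //= m IH; rewrite size_sigma IH expnS mul2n. Qed.

Lemma sigma_cat u v : sigma (u ++ v) = sigma u ++ sigma v.
Proof. by rewrite /sigma map_cat flatten_cat. Qed.

Lemma A_chop m : A m = rcons (chop (A m)) (delta m).
Proof.
have: 0 < size (A m) by rewrite size_A expn_gt0.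
rewrite /delta /chop; case/lastP: (A m) => // s x _.
by rewrite size_rcons last_rcons -{2}cats1 take_size_cat.
Qed.

Lemma A_prefixS m : exists v, A m.+1 = A m ++ v.
Proof.
elim: m => [|m [v IH]]; first by exists [:: Lb].
by exists (sigma v); rewrite [LHS]AS {1}IH sigma_cat -AS.
Qed.

Lemma A_prefixD m k : exists v, A (m + k) = A m ++ v.
Proof.
elim: k => [|k [v IH]]; first by exists [::]; rewrite addn0 cats0.
have [u] := A_prefixS (m + k); rewrite addnS IH => ->.
by exists (v ++ u); rewrite catA.
Qed.

Lemma nth_A m n : n < 2 ^ m -> nth La (A m) n = D n.
Proof.
have pre k l j : k <= l -> j < 2 ^ k -> nth La (A l) j = nth La (A k) j.
  move=> le_kl lt_j; have [v] := A_prefixD k (l - k).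
  by rewrite subnKC // => ->; rewrite nth_cat size_A lt_j.
move=> lt_n; rewrite /D; case/orP: (leq_total m n) => le_mn.
  by rewrite (pre m n).
by rewrite (pre n m) // ltn_expl.
Qed.

Lemma A_prefix_D m : A m = mkseq D (2 ^ m).
Proof.
apply: (@eq_from_nth _ La); rewrite size_A ?size_mkseq // => n lt_n.
by rewrite nth_mkseq // nth_A.
Qed.

Lemma D_start : D 0 = La.
Proof. by []. Qed.

Lemma D_fixed n : sigma (mkseq D n) = mkseq D n.*2.
Proof.
have mkD m k : k <= 2 ^ m -> mkseq D k = take k (A m).
  move=> le_k; rewrite A_prefix_D /mkseq -map_take take_iota.
  by move/minn_idPl: le_k => ->.
have le_n : n <= 2 ^ n by rewrite ltnW // ltn_expl.
have le_2n : n.*2 <= 2 ^ n.+1 by rewrite expnS mul2n leq_double.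
rewrite (mkD _ _ le_2n) (mkD _ _ le_n) AS.
rewrite -{2}(cat_take_drop n (A n)) sigma_cat take_size_cat //.
by rewrite size_sigma size_take_min size_A; move/minn_idPl: le_n => ->.
Qed.

(* Main.v *)
(** The letters of [D] satisfy [D (2n) = a] and [D (2n+1) <> D n], and the
    envelope words satisfy [E (m+1) i = sigma (E m i) a].  A factor [w] that is
    not contained in [aa] occurs only at positions of one parity, so it has a
    unique shortest extension of the form [sigma v a], and passing from [w] to
    [v] turns occurrences of [w] into occurrences of [v] and lowers the index of
    the envelope by one.  By descent to [w = a] or [w = aa], all occurrences of
    [w] sit at the same offset inside occurrences of [Env w]; hence the [p]-th
    occurrence of one lies in the [p]-th occurrence of the other. *)

Require Import Defs.
From mathcomp Require Import all_boot zify.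

(** * Letters at even and odd positions *)

Definition flip (x : letter) : letter := if x is La then Lb else La.

Lemma flip_inj : injective flip.
Proof. by case; case. Qed.

Lemma sigma_mkseq_rcons (f : nat -> letter) n :
  sigma (mkseq f n.+1) = sigma (mkseq f n) ++ [:: La; flip (f n)].
Proof.
by rewrite mkseqS -cats1 sigma_cat; congr (_ ++ _); rewrite /sigma /=; case: (f n).
Qed.

Lemma D_double_pair n : (D n.*2 = La) * (D n.*2.+1 = flip (D n)).
Proof.
have := D_fixed n.+1; rewrite sigma_mkseq_rcons D_fixed doubleS !mkseqS.
rewrite -!cats1 -!catA => /(congr1 (drop n.*2)).
by rewrite !drop_size_cat ?size_mkseq // => -[-> ->].
Qed.

Lemma D_double n : D n.*2 = La.
Proof. by rewrite D_double_pair. Qed.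

Lemma D_doubleS n : D n.*2.+1 = flip (D n).
Proof. by rewrite D_double_pair. Qed.

Lemma D_odd n : D n = Lb -> odd n.
Proof.
by rewrite -{1}[n]odd_double_half; case: (odd n) => //; rewrite add0n D_double.
Qed.

(* [D n] is governed by the 2-adic valuation of [n + 1], which the multiples of
   [2 ^ k] do not change when [n + 1 < 2 ^ k]. *)
Lemma D_recurrent k j t : j.+1 < 2 ^ k -> D (j + 2 ^ k * t) = D j.
Proof.
elim: k j => [|k IH] j; first by rewrite expn0.
rewrite expnS => lt_j.
have -> : j + 2 * 2 ^ k * t = odd j + (j./2 + 2 ^ k * t).*2 by lia.
rewrite -{3}[j]odd_double_half.
case: (odd j) (odd_double_half j) => /= ej; last by rewrite !add0n !D_double.
by rewrite !add1n !D_doubleS IH //; lia.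
Qed.

(** * Factors given by position and length, and their halving *)

Definition agree (n n' l : nat) : Prop := forall j, j < l -> D (n + j) = D (n' + j).

Lemma agree_sym n n' l : agree n n' l -> agree n' n l.
Proof. by move=> h j lt_j; rewrite h. Qed.

Lemma agree_sub n n' l o k : agree n n' l -> o + k <= l -> agree (n + o) (n' + o) k.
Proof. by move=> h le_l j lt_j; rewrite -!addnA h //; lia. Qed.

Lemma agree_double n n' l : agree n n' l -> agree n.*2 n'.*2 l.*2.+1.
Proof.
move=> h j lt_j.
have eD q : q.*2 + j = odd j + (q + j./2).*2 by lia.
rewrite !eD; case: (odd j) (odd_double_half j) => /= ej.
  by rewrite !add1n !D_doubleS h //; lia.
by rewrite !add0n !D_double.
Qed.

(* [sigma v a] is the shortest extension, from an even position to an even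
   position, of the factor of length [l] at position [n]; it has
   [v] at position [n./2], of length [half_length n l]. *)
Definition half_length (n l : nat) : nat := (n + l)./2 - n./2.

(** A letter [D q] is recovered from the odd position [q.*2.+1], and [half_length n l] counts the
    odd positions in the window. *)
Lemma agree_half n n' l : odd n = odd n' ->
  agree n n' l -> agree n./2 n'./2 (half_length n l).
Proof.
rewrite /half_length => eq_odd h j lt_j; apply: flip_inj; rewrite -!D_doubleS.
have -> : (n./2 + j).*2.+1 = n + (j.*2.+1 - odd n) by lia.
have -> : (n'./2 + j).*2.+1 = n' + (j.*2.+1 - odd n) by lia.
by apply: h; lia.
Qed.

Definition sub (n l : nat) : word := mkseq (fun j => D (n + j)) l.

Lemma size_sub n l : size (sub n l) = l.
Proof. exact: size_mkseq. Qed.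

Lemma eq_sub n n' l : sub n l = sub n' l <-> agree n n' l.
Proof.
split=> [e j lt_j | h]; last first.
  by apply: (@eq_from_nth _ La); rewrite !size_sub // => j lt_j; rewrite !nth_mkseq ?h.
by move/(congr1 (fun s => nth La s j)): e; rewrite !nth_mkseq.
Qed.

Lemma occurs_atE w n : occurs_at w n = (sub n (size w) == w).
Proof. by []. Qed.

Lemma occurs_at_sub n l n' : occurs_at (sub n l) n' <-> agree n n' l.
Proof.
rewrite occurs_atE size_sub.
by split=> [/eqP/eq_sub/agree_sym | /agree_sym/eq_sub/eqP].
Qed.

Lemma sub_cat n k l : sub n (k + l) = sub n k ++ sub (n + k) l.
Proof.
rewrite /sub /mkseq iotaD map_cat; congr (_ ++ _).
rewrite add0n -[X in iota X]addn0 iotaDl -map_comp.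
by apply: eq_map => j /=; rewrite addnA.
Qed.

Lemma infix_sub n l p k :
  infix (sub n l) (sub p k) <-> exists2 o, o + l <= k & agree n (p + o) l.
Proof.
split=> [/infixP[s1 [s2 e]] | [o le_k /eq_sub ->]].
  have := congr1 size e; rewrite !size_cat !size_sub => ek.
  exists (size s1); first by lia.
  apply/eq_sub; move: e; rewrite ek !sub_cat => /(congr1 (drop (size s1))).
  rewrite !drop_size_cat ?size_sub // => /(congr1 (take l)).
  by rewrite !take_size_cat ?size_sub.
apply/infixP; exists (sub p o), (sub (p + o + l) (k - (o + l))).
by rewrite -!sub_cat addnA subnKC.
Qed.

Lemma sigma_sub n l : sigma (sub n l) ++ [:: La] = sub n.*2 l.*2.+1.
Proof.
have -> : sub n.*2 l.*2.+1 = sub n.*2 l.*2 ++ [:: La].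
  by rewrite /sub mkseqS -cats1 -doubleD D_double.
congr (_ ++ _); elim: l => //= l IH.
rewrite /sub sigma_mkseq_rcons -/(sub _ _) IH doubleS !mkseqS -!cats1 -catA.
by rewrite addnS -doubleD D_double D_doubleS.
Qed.

(** * Envelope words under the morphism *)

Lemma chop_rcons s x : chop (rcons s x) = s.
Proof. by rewrite /chop size_rcons -cats1 take_size_cat. Qed.

Lemma E_S m i : 0 < m -> E m.+1 i = sigma (E m i) ++ [:: La].
Proof.
case: m => // m _; rewrite /E.
have -> : chop (A m.+2) = sigma (chop (A m.+1)) ++ [:: La].
  rewrite AS {1}A_chop -cats1 sigma_cat.
  (* The image of the removed letter has two letters; chopping drops only the second, which leaves
     the final a. *)
  have -> : sigma [:: delta m.+1] = [:: La; flip (delta m.+1)] by case: (delta _).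
  by rewrite -[[:: La; _]]/([:: La] ++ [:: flip (delta m.+1)]) catA cats1 chop_rcons.
by case: (i == 1); rewrite // sigma_cat -catA.
Qed.

Lemma E_factor m i : env_index m i -> exists n l, E m i = sub n l.
Proof.
case: m => // m /andP[_ i12]; elim: m => [|m [n [l IH]]].
  (* The sequence starts with abaa, and the two envelope words of index 1 are a and aa. *)
  by case/orP: i12 => /eqP->; [exists 0, 1 | exists 2, 2].
by exists n.*2, l.*2.+1; rewrite E_S // IH sigma_sub.
Qed.

(** * Parity of occurrences and descent to halves *)

Lemma no_aaa_odd n : odd n -> ~ (D n = La /\ D n.+2 = La).
Proof.
move=> odd_n; have -> : n = n./2.*2.+1 by lia.
rewrite -doubleS !D_doubleS => -[].
(* Only the case of b at two consecutive positions survives, but b occurs at odd positions only. *)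
case e: (D n./2) => // _; case e': (D n./2.+1) => // _.
by move: (D_odd _ e) (D_odd _ e'); rewrite /= => ->.
Qed.

Lemma infix_aa w : Lb \notin w -> size w <= 2 -> infix w [:: La; La].
Proof. by case: w => [|[] [|[] [|? ?]]]. Qed.

(** A letter b fixes the parity. Without b, the factor is a power of a of length at least 3, which
    starts at even positions only. *)
Lemma agree_odd n n' l :
  ~~ infix (sub n l) [:: La; La] -> agree n n' l -> odd n = odd n'.
Proof.
move=> not_aa h.
have [/mapP[j] | no_b] := boolP (Lb \in sub n l).
  rewrite mem_iota add0n => /= lt_j e.
  have := D_odd _ (esym e); rewrite (h j lt_j) in e.
  by have := D_odd _ (esym e); lia.
have lt2l : 2 < l.
  by rewrite ltnNge; apply: contra not_aa => le2; apply: infix_aa; rewrite ?size_sub.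
have all_a j : j < l -> D (n + j) = La.
  move=> lt_j; case e: (D (n + j)) => //; case/negP: no_b.
  by apply/mapP; exists j; rewrite ?mem_iota.
have even q : agree n q l -> ~~ odd q.
  move=> hq; apply/negP => /no_aaa_odd; apply.
  by rewrite -(addn0 q) -addn2 -addnA -!hq ?all_a //; lia.
by rewrite (negbTE (even n _)) // (negbTE (even n' _)).
Qed.

Lemma infix_half n l p k : ~~ infix (sub n l) [:: La; La] ->
  infix (sub n l) (sub p.*2 k.*2.+1)
  <-> infix (sub n./2 (half_length n l)) (sub p k).
Proof.
move=> not_aa; split=> /infix_sub[o le_k h]; apply/infix_sub.
  have eq_odd := agree_odd _ _ _ not_aa h.
  exists (o./2); first by rewrite /half_length; lia.
  have -> : p + o./2 = (p.*2 + o)./2 by lia.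
  exact: agree_half.
exists (o.*2 + odd n); first by move: le_k; rewrite /half_length; lia.
have := agree_sub _ _ _ (odd n) l (agree_double _ _ _ h).
have -> : n./2.*2 + odd n = n by lia.
have -> : (p + o).*2 + odd n = p.*2 + (o.*2 + odd n) by lia.
by apply; rewrite /half_length; lia.
Qed.

Lemma half_length_gt0 n l : ~~ infix (sub n l) [:: La; La] -> 0 < half_length n l.
Proof.
rewrite /half_length; case: l => [|[|l]]; rewrite ?infix0s //; last by lia.
(* A single letter not in aa is b, and its odd position contributes one letter to the half. *)
rewrite /sub /= addn0 => not_aa; have := D_odd n.
by case: (D n) not_aa => // _ /(_ erefl); lia.
Qed.

Lemma not_infix_aa w m i : is_Env w m.+2 i -> ~~ infix w [:: La; La].
Proof.
(* [E 1 2] is aa, and it precedes every envelope word of index at least 2. *)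
by move=> [_ _ min]; apply/negP => h; have := min 1 2 isT h.
Qed.

Lemma is_Env_half n l m i : is_Env (sub n l) m.+2 i ->
  is_Env (sub n./2 (half_length n l)) m.+1 i.
Proof.
move=> env; have not_aa := not_infix_aa _ _ _ env.
have infixE m' i' : env_index m' i' ->
    infix (sub n l) (E m'.+1 i') <-> infix (sub n./2 (half_length n l)) (E m' i').
  move=> idx; have [p [k eE]] := E_factor _ _ idx.
  have m'_gt0 : 0 < m' by case/andP: idx.
  by rewrite E_S // eE sigma_sub; apply: infix_half.
case: env => idx inf min; split=> //.
  by apply/(infixE m.+1 i).
move=> m' i' idx' /(infixE _ _ idx') inf'.
have idxS : env_index m'.+1 i' by case/andP: idx'.
by have := min _ _ idxS inf'; rewrite /env_lt ltnS eqSS.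
Qed.

(** Minimality rules out a inside aa, the one case where the offset would be ambiguous. *)
Lemma is_Env_base w i : w <> [::] -> is_Env w 1 i -> w = E 1 i.
Proof.
move=> w_neq0 [/andP[_ /orP[] /eqP-> inf min]].
  by case: w inf w_neq0 {min} => [|[] [|? ?]].
have := min 1 1 isT; rewrite /env_lt /= => not_a.
by case: w inf w_neq0 not_a {min} => [|[] [|[] [|? ?]]] // _ _ /(_ isT).
Qed.

Lemma constant_offset m i n l : 0 < l -> is_Env (sub n l) m.+1 i ->
  exists2 j, j + l <= size (E m.+1 i) &
    forall n', agree n n' l -> j <= n' /\ occurs_at (E m.+1 i) (n' - j).
Proof.
elim: m n l => [|m IH] n l l_gt0 env.
  have <- : sub n l = E 1 i.
    by apply: is_Env_base env => /(congr1 size); rewrite size_sub /=; lia.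
  exists 0; first by rewrite size_sub.
  by move=> n' h; rewrite subn0; split=> //; apply/occurs_at_sub.
have not_aa := not_infix_aa _ _ _ env.
have [j le_j IHj] := IH _ _ (half_length_gt0 _ _ not_aa) (is_Env_half _ _ _ _ env).
have idx : env_index m.+1 i by case: env => /andP[].
have [p [k eE]] := E_factor _ _ idx.
move: le_j; rewrite (E_S m.+1) // eE sigma_sub !size_sub => le_j.
(* The offset of the half doubles, plus one when the factor starts at an odd position; this parity
   is the same for all its occurrences. *)
exists (j.*2 + odd n); first by move: le_j; rewrite /half_length; lia.
move=> n' h; have eq_odd := agree_odd _ _ _ not_aa h.
have [le_jn] := IHj _ (agree_half _ _ _ eq_odd h).
rewrite eE => /occurs_at_sub/agree_double/occurs_at_sub occ; split; first by lia.
by have <- : (n'./2 - j).*2 = n' - (j.*2 + odd n) by lia.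
Qed.

(** * Ranks of occurrences *)

Section Counting.

Implicit Types (P Q : pred nat) (n p : nat).

Definition nth_true P p n := P n && (count P (iota 0 n.+1) == p).

Lemma count_iotaS P n : count P (iota 0 n.+1) = count P (iota 0 n) + P n.
Proof. by rewrite -addn1 iotaD count_cat /= addn0 add0n. Qed.

Lemma nth_true_exists P p :
  (forall n, exists2 n', n <= n' & P n') -> 0 < p -> exists n, nth_true P p n.
Proof.
move=> unbounded p_gt0.
have exN : exists n, p <= count P (iota 0 n).
  elim: p {p_gt0} => [|p [n le_n]]; first by exists 0.
  have [n' le_nn' Pn'] := unbounded n.
  exists n'.+1; rewrite count_iotaS Pn' addn1 ltnS (leq_trans le_n) //.
  by rewrite -(subnKC le_nn') iotaD count_cat leq_addr.
(* The least bound at which the count reaches [p] is a successor [n.+1]; the count jumps exactly at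
   [n]. *)
case: (ex_minnP exN) => -[|n]; first by rewrite /=; lia.
move=> le_p min; exists n; rewrite /nth_true.
have := min n; move: le_p; rewrite count_iotaS; case: (P n); lia.
Qed.

Lemma nth_true_inj P p n n' : nth_true P p n -> nth_true P p n' -> n = n'.
Proof.
wlog lt_n : n n' / n < n' => [wl h h'|].
  by case: (ltngtP n n') => // lt_n; [apply: wl | symmetry; apply: wl].
move=> /andP[_ /eqP ep] /andP[Pn' /eqP]; rewrite count_iotaS Pn' -(subnKC lt_n).
by rewrite iotaD count_cat ep; lia.
Qed.

(** [P] is [Q] translated by [j] and is empty below [j], so ranks are preserved. *)
Lemma nth_true_shift P Q j p n :
    (forall k, P k -> j <= k /\ Q (k - j)) -> (forall k, Q k -> P (j + k)) ->
  nth_true Q p n -> nth_true P p (j + n).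
Proof.
move=> PQ QP /andP[Qn /eqP <-]; rewrite /nth_true QP // -addnS iotaD count_cat.
have -> : count P (iota 0 j) = 0.
  apply/eqP; rewrite -leqn0 leqNgt -has_count; apply/hasPn => k.
  by rewrite mem_iota add0n => lt_k; apply/negP => /PQ[]; lia.
rewrite add0n -[X in iota X](addn0 j) iotaDl count_map; apply/eqP/eq_count => k /=.
by apply/idP/idP=> [/PQ[_] | /QP //]; rewrite addKn.
Qed.

End Counting.

Lemma occurs_at_unbounded w : factor_of_D w ->
  forall n, exists2 n', n <= n' & occurs_at w n'.
Proof.
case=> q /eqP <- n; set l := size w.
have lt_k : q + l + 1 < 2 ^ (q + l + 1) by apply: ltn_expl.
(* The power of 2 exceeds every position of the window at [q], so [D_recurrent] copies all its
   letters. *)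
exists (q + 2 ^ (q + l + 1) * n); first by nia.
apply/occurs_at_sub => j lt_j.
by rewrite addnAC D_recurrent //; lia.
Qed.

Lemma occurs_at_middle u v w n :
  occurs_at (u ++ v ++ w) n -> occurs_at v (n + size u).
Proof.
rewrite !occurs_atE !size_cat !sub_cat => /eqP/(congr1 (drop (size u))).
rewrite !drop_size_cat ?size_sub // => /(congr1 (take (size v))).
by rewrite !take_size_cat ?size_sub // => ->.
Qed.

Lemma envelope_offset w m i : w <> [::] -> factor_of_D w -> is_Env w m i ->
  exists mu : word * word, E m i = mu.1 ++ w ++ mu.2 /\
    forall n, occurs_at w n -> size mu.1 <= n /\ occurs_at (E m i) (n - size mu.1).
Proof.
case: m => [|m] w_neq0 [n]; first by move=> _ [].
rewrite occurs_atE => /eqP ew env.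
have l_gt0 : 0 < size w by case: w w_neq0 {ew env}.
move: env; rewrite -ew => /(constant_offset _ _ _ _ l_gt0)[j le_j h].
have [le_jn] := h n (fun _ _ => erefl); rewrite occurs_atE => /eqP.
rewrite -(subnKC le_j) !sub_cat subnK // -catA => eE.
(* Both words are read off around one occurrence of [w]; the constant offset makes them serve all
   occurrences. *)
exists (sub (n - j) j, sub (n - j + (j + size w)) (size (E m.+1 i) - (j + size w))).
rewrite size_sub; split; first exact: esym eE.
by move=> n' /occurs_at_sub; apply: h.
Qed.

Theorem theorem5p1 (w : word) (m i : nat)
    (w_nonempty : w <> [::]) (w_factor : factor_of_D w)
    (w_env : is_Env w m i) :
  exists mu : word * word,
    forall p : nat, 1 <= p -> unique (envelope_extension w m i p) mu.
Proof.
have [mu [eE w_E]] := envelope_offset _ _ _ w_nonempty w_factor w_env.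
have E_w n : occurs_at (E m i) n -> occurs_at w (size mu.1 + n).
  by rewrite eE addnC; apply: occurs_at_middle.
exists mu => p p_gt0; split.
  have E_factor : factor_of_D (E m i).
    by case: w_factor => n /w_E[_]; exists (n - size mu.1).
  have [l lp] := nth_true_exists _ _ (occurs_at_unbounded _ E_factor) p_gt0.
  exists (size mu.1 + l), l; split=> //; last exact: addnC.
  exact: nth_true_shift w_E E_w lp.
move=> [u v] [k [l [/= kp lp eE' ek]]].
have wl := nth_true_shift _ _ _ _ _ w_E E_w lp.
(* Both extensions place the same occurrence of [w] in the same occurrence of the envelope, so the
   prefixes have equal length. *)
have eu : size mu.1 = size u by have := nth_true_inj _ _ _ _ kp wl; lia.
move: eE'; rewrite eE => /eqP; rewrite eqseq_cat // => /andP[/eqP eu'].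
by rewrite eqseq_cat // eqxx => /eqP ev; rewrite -eu' -ev -surjective_pairing.
Qed.
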